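(* Suppose $\mathsf{S}$ is an $m$-coin pseudorandom generation $(\epsilon',\delta')$-steward for $k$ adaptively chosen $(\epsilon,\delta)$-concentrated functions $f_1,\dots,f_k:\{0,1\}^n\to\mathbb{R}^d$. Then \[ m \ge (1-\delta')\cdot(n - \log_2(2/\delta))\cdot k. \]
   Context: A function $f: \{0,1\}^n \to \mathbb{R}^d$ is $(\epsilon,\delta)$-concentrated at $\mu \in \mathbb{R}^d$ if $\Pr_{X}[\|f(X) - \mu\|_\infty > \epsilon] \le \delta$ for uniform $X\in\{0,1\}^n$. An $(\epsilon', \delta')$-steward for $k$ adaptively chosen $(\epsilon,\delta)$-concentrated functions is a randomized algorithm $\mathsf{S}$ interacting with an arbitrary (possibly randomized) owner $\mathsf{O}$: for $i = 1,\dots,k$, $\mathsf{O}$ adaptively chooses $f_i$ that is $(\epsilon,\delta)$-concentrated at some $\mu_i\in\mathbb{R}^d$ and gives it to $\mathsf{S}$, which returns $Y_i \in \mathbb{R}^d$; for every $\mathsf{O}$, $\Pr[\max_i \|Y_i - \mu_i\|_\infty > \epsilon'] \le \delta'$. It is one-query if it accesses each $f_i$ only by evaluating it at a single point $X_i$ (not seen by the owner). It is $m$-coin if it uses $m$ uniformly random bits. A pseudorandom generation steward is a one-query steward which in each round returns exactly the query response, $Y_i = f_i(X_i)$ (the query point $X_i$ may depend on previous responses). *)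

(* Defs.v *)
From HB Require Import structures.
From mathcomp Require Import all_boot all_order all_algebra.
From mathcomp Require Import all_classical all_reals all_analysis.

Set Implicit Arguments.
Unset Strict Implicit.
Unset Printing Implicit Defensive.

Import Order.TTheory GRing.Theory Num.Theory.
Import numFieldNormedType.Exports.

Local Open Scope classical_set_scope.
Local Open Scope ring_scope.

Definition log2 {R : realType} (x : R) : R := ln x / ln 2.

Notation cube n := (n.-tuple bool).

Definition cube_fun (R : realType) (n d : nat) : Type := cube n -> 'rV[R]_d.

(* The norm of a row vector is the maximum of the absolute values of its
   entries. *)
Definition concentrated (R : realType) (n d : nat) (eps delta : R)
    (f : cube_fun R n d) (mu : 'rV[R]_d) : Prop :=
  #|[pred x : cube n | eps < `|f x - mu|]|%:R / #|{: cube n}|%:R <= delta.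

(* An interactive algorithm with m random bits: from the outcome of its coins
   and the functions f_1, ..., f_i received so far (oldest first), it computes
   the answer Y_i.  Its earlier answers are determined by the same data. *)
Definition coin_algorithm (R : realType) (n d m : nat) : Type :=
  cube m -> seq (cube_fun R n d) -> 'rV[R]_d.

(* An owner whose private randomness is a point of W: from this randomness and
   the answers Y_1, ..., Y_(i-1) received so far (oldest first), it chooses the
   function f_i and the point mu_i. *)
Definition owner_strategy (R : realType) (n d : nat) (W : Type) : Type :=
  W -> seq 'rV[R]_d -> cube_fun R n d * 'rV[R]_d.

Definition valid_owner (R : realType) (n d : nat) (W : Type) (eps delta : R)
    (O : owner_strategy R n d W) : Prop :=
  forall w ys, concentrated eps delta (O w ys).1 (O w ys).2.

(* The list of the triples (f_i, mu_i, Y_i), for i = 1, ..., k. *)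
Fixpoint transcript (R : realType) (n d m : nat) (W : Type)
    (S : coin_algorithm R n d m) (O : owner_strategy R n d W)
    (c : cube m) (w : W) (k : nat)
    : seq (cube_fun R n d * 'rV[R]_d * 'rV[R]_d) :=
  if k is k'.+1 then
    let t := transcript S O c w k' in
    let: (f, mu) := O w [seq r.2 | r <- t] in
    rcons t (f, mu, S c (rcons [seq r.1.1 | r <- t] f))
  else [::].

Definition steward_fails (R : realType) (n d m : nat) (W : Type)
    (S : coin_algorithm R n d m) (O : owner_strategy R n d W)
    (c : cube m) (w : W) (k : nat) (eps' : R) : bool :=
  has (fun r => eps' < `|r.2 - r.1.2|) (transcript S O c w k).

(* The probability of failure is over the uniform coins of S and the
   independent randomness of the owner. The owner's randomness may live on any
   probability space, provided that failure is an event. *)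
Definition steward (R : realType) (n d m : nat) (k : nat)
    (eps' delta' eps delta : R) (S : coin_algorithm R n d m) : Prop :=
  forall (disp : measure_display) (W : measurableType disp)
    (P : probability W R) (O : owner_strategy R n d W),
  valid_owner eps delta O ->
  (forall c, measurable [set w | steward_fails S O c w k eps']) ->
  ((#|{: cube m}|%:R^-1)%:E *
     \sum_(c : cube m) P [set w | steward_fails S O c w k eps']
   <= delta'%:E)%E.

Definition query_rule (R : realType) (n d m : nat) : Type :=
  cube m -> seq 'rV[R]_d -> cube n.

(* f_1(X_1), ..., f_i(X_i), where X_j is chosen by the rule q from the coins and
   f_1(X_1), ..., f_(j-1)(X_(j-1)). *)
Definition responses (R : realType) (n d m : nat) (q : query_rule R n d m)
    (c : cube m) (fs : seq (cube_fun R n d)) : seq 'rV[R]_d :=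
  foldl (fun r f => rcons r (f (q c r))) [::] fs.

Definition one_query_with (R : realType) (n d m : nat)
    (q : query_rule R n d m) (S : coin_algorithm R n d m) : Prop :=
  exists post : cube m -> seq 'rV[R]_d -> 'rV[R]_d,
  forall c fs, S c fs = post c (responses q c fs).

Definition pseudorandom_generation (R : realType) (n d m : nat)
    (S : coin_algorithm R n d m) : Prop :=
  exists q : query_rule R n d m, one_query_with q S /\
  forall c fs f, S c (rcons fs f) = f (q c (responses q c fs)).

(* Main.v *)
(** An owner can let a round's answer encode the query point injectively inside
    the [eps]-ball around [mu = 0], so that the past answers [ys] reveal the past
    query points.  It then moves [f] far away on the heavy points: those [x] for
    which more than a [1/D] fraction of the coin outcomes compatible with [ys]
    remain compatible once [x] is queried, where [D = delta * 2^n].  There are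
    at most [D] of them, so [f] is concentrated, and every round that does not
    fail divides the number of compatible coin outcomes by [D].  Since
    [delta' < 1], some coin outcome survives all [k] rounds, and [D ^ k <= 2 ^ m]. *)
Require Import Defs.
From mathcomp Require Import all_boot all_order all_algebra.
From mathcomp Require Import all_classical all_reals all_analysis.
From mathcomp Require Import ring.
Import Order.TTheory GRing.Theory Num.Theory.
Import numFieldNormedType.Exports.
Local Open Scope ring_scope.

Lemma norm_const_row (R : realType) (d : nat) (a : R) :
  (0 < d)%N -> `|const_mx a : 'rV[R]_d| = `|a|.
Proof.
case: d => // d _; rewrite [LHS]/Num.norm /= mx_normrE; apply/le_anti/andP; split.
  by apply: bigmax_le => // -[i j] _; rewrite mxE.
rewrite (le_trans _ (le_bigmax _ (fun ij : 'I_1 * 'I_d.+1 => _) (ord0, ord0)))//=.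
by rewrite mxE.
Qed.

(** Constant rows suffice: the ranks of the points of [T], scaled by [eps / #|T|], are distinct and
    lie in [[0, eps)]. *)
Lemma exists_small_injection {R : realType} (T : finType) {d : nat} {eps : R} :
  (0 < d)%N -> 0 < eps ->
  exists2 e : T -> 'rV[R]_d, injective e & forall x, `|e x| <= eps.
Proof.
move=> d_gt0 eps_gt0.
exists (fun x => const_mx (eps * (enum_rank x)%:R / #|T|%:R)) => [x y|x].
  move=> /matrixP/(_ ord0 (Ordinal d_gt0)); rewrite !mxE => exy.
  have T_neq0 : #|T|%:R != 0 :> R.
    by rewrite pnatr_eq0 -lt0n (leq_ltn_trans _ (ltn_ord (enum_rank x))).
  apply/enum_rank_inj/val_inj/eqP; rewrite -(eqr_nat R); apply/eqP.
  by apply: (mulfI (lt0r_neq0 eps_gt0)); apply: (mulIf (invr_neq0 T_neq0)).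
have rank_lt := ltn_ord (enum_rank x).
rewrite norm_const_row// ger0_norm ?divr_ge0 ?mulr_ge0 ?(ltW eps_gt0)//.
rewrite ler_pdivrMr ?ltr0n ?(leq_ltn_trans _ rank_lt)//.
by rewrite ler_pM2l// ler_nat ltnW.
Qed.

(** Markov's inequality for counting: each counted point has weight above [N / D], out of a total of
    at most [N]. *)
Lemma card_heavy_le (R : realType) (T : finType) (w : T -> nat) (N : nat)
    (D : R) : 0 < D -> (\sum_x w x <= N)%N ->
  #|[pred x | N%:R < (w x)%:R * D]|%:R <= D.
Proof.
move=> D_gt0 wN; case: (posnP N) => [N0|N_gt0].
  rewrite eq_card0 ?ltW// => x; rewrite !inE.
  have /eqP-> : w x == 0%N.
    by rewrite -leqn0 -N0 (leq_trans _ wN)// (bigD1 x)//= leq_addr.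
  by rewrite N0 mul0r ltxx.
rewrite -(ler_pM2r (_ : 0 < N%:R :> R)) ?ltr0n//.
rewrite -sum1_card natr_sum mulr_suml.
apply: (@le_trans _ _ (\sum_(x | N%:R < (w x)%:R * D) (w x)%:R * D)).
  by apply: ler_sum => x /ltW; rewrite mul1r.
rewrite -mulr_suml mulrC ler_pM2l// -natr_sum ler_nat.
by rewrite (leq_trans _ wN)// [leqRHS](bigID (fun x => N%:R < (w x)%:R * D))/=
  leq_addr.
Qed.

(** The answers on coins [c] if every function were [e] itself. The adversary's functions differ
    from [e] only at heavy points, so runs without failure follow this replay; using [e] here keeps
    the definition of the adversary from being circular. *)
Definition replay {R : realType} {n d m : nat} (q : query_rule R n d m)
    (e : cube_fun R n d) (c : cube m) (j : nat) : seq 'rV[R]_d :=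
  iter j (fun ys => rcons ys (e (q c ys))) [::].

Definition compatible {R : realType} {n d m : nat} (q : query_rule R n d m)
    (e : cube_fun R n d) (ys : seq 'rV[R]_d) : pred (cube m) :=
  [pred c | replay q e c (size ys) == ys].

Definition heavy {R : realType} {n d m : nat} (q : query_rule R n d m)
    (e : cube_fun R n d) (D : R) (ys : seq 'rV[R]_d) : pred (cube n) :=
  [pred x | #|compatible q e ys|%:R < #|compatible q e (rcons ys (e x))|%:R * D].

Definition adversary {R : realType} {n d m : nat} (q : query_rule R n d m)
    (e : cube_fun R n d) (D : R) (far : 'rV[R]_d) : owner_strategy R n d unit :=
  fun _ ys => (fun x => if heavy q e D ys x then far else e x, 0).

Lemma compatible_rcons (R : realType) (n d m : nat) (q : query_rule R n d m)
    (e : cube_fun R n d) (ys : seq 'rV[R]_d) (y : 'rV[R]_d) (c : cube m) :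
  (c \in compatible q e (rcons ys y))
    = (c \in compatible q e ys) && (e (q c ys) == y).
Proof.
rewrite !inE size_rcons /= eqseq_rcons.
by case: eqP => //= ->.
Qed.

(** Since [e] is injective, a compatible [c] stays compatible for the single point [x = q c ys], so
    the sets for different [x] partition the compatible outcomes. *)
Lemma card_heavy {R : realType} {n d m : nat} (q : query_rule R n d m)
    {e : cube_fun R n d} (D : R) (ys : seq 'rV[R]_d) :
  injective e -> 0 < D -> #|heavy q e D ys|%:R <= D.
Proof.
move=> e_inj D_gt0; apply: card_heavy_le => //.
rewrite -[leqRHS]sum1_card (partition_big (q^~ ys) xpredT)//=.
apply: leq_sum => x _; rewrite sum1_card; apply: subset_leq_card.
apply/fintype.subsetP => c.
by rewrite compatible_rcons (inj_eq e_inj).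
Qed.

Lemma valid_adversary {R : realType} {n d m : nat} (q : query_rule R n d m)
    {e : cube_fun R n d} {eps delta : R} (far : 'rV[R]_d) :
  injective e -> (forall x, `|e x| <= eps) -> 0 < delta ->
  valid_owner eps delta (adversary q e (delta * #|{: cube n}|%:R) far).
Proof.
move=> e_inj e_le delta_gt0 w ys; rewrite /concentrated /=.
have cube_gt0 : 0 < #|{: cube n}|%:R :> R.
  by rewrite ltr0n card_tuple card_bool expn_gt0.
set D := delta * _; have D_gt0 : 0 < D by rewrite mulr_gt0.
rewrite ler_pdivrMr// (le_trans _ (card_heavy q D ys e_inj D_gt0))//.
rewrite ler_nat; apply: subset_leq_card; apply/fintype.subsetP => x.
rewrite !unfold_in subr0; case: ifP => [//|_].
by rewrite ltNge e_le.
Qed.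

(** Links the two histories: the rule [q] sees responses recomputed from the functions, the owner
    sees the answers in the transcript. *)
Lemma transcript_responses (R : realType) (n d m : nat) (W : Type)
    (q : query_rule R n d m) (S : coin_algorithm R n d m)
    (O : owner_strategy R n d W) (c : cube m) (w : W) (j : nat) :
  (forall c fs f, S c (rcons fs f) = f (q c (responses q c fs))) ->
  responses q c [seq r.1.1 | r <- transcript S O c w j]
    = [seq r.2 | r <- transcript S O c w j].
Proof.
move=> S_q; elim: j => //= j IH; case: (O w _) => f mu.
by rewrite !map_rcons /= S_q IH /responses foldl_rcons -/(responses q c _) IH.
Qed.

(** By induction on the rounds: without failure each query is light, so its answer agrees with [e],
    [c] remains compatible, and lightness pays for one more factor [D]. *)
Lemma surviving_round {R : realType} {n d m : nat} {q : query_rule R n d m}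
    {S : coin_algorithm R n d m} {e : cube_fun R n d} {D eps' : R}
    {far : 'rV[R]_d} {c : cube m} {w : unit} {j : nat} :
  (forall c fs f, S c (rcons fs f) = f (q c (responses q c fs))) ->
  eps' < `|far| -> 0 < D ->
  ~~ steward_fails S (adversary q e D far) c w j eps' ->
  let ys := [seq r.2 | r <- transcript S (adversary q e D far) c w j] in
  c \in compatible q e ys /\ #|compatible q e ys|%:R * D ^+ j <= 2 ^+ m.
Proof.
move=> S_q far_gt D_gt0.
elim: j => [_|j IH] /=.
  split=> //; rewrite expr0 mulr1 -natrX ler_nat.
  by rewrite (leq_trans (max_card _))// card_tuple card_bool.
rewrite /steward_fails /= has_rcons negb_or map_rcons /= => /andP[].
set ys := map _ _ => ok_last /IH[c_ys card_ys].
move: ok_last; rewrite S_q transcript_responses// -/ys subr0.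
(* A heavy query would return [far], more than [eps'] away from [mu = 0]. *)
case: ifPn => [_|light _]; first by rewrite far_gt.
split; first by rewrite compatible_rcons c_ys eqxx.
rewrite exprS mulrA (le_trans _ card_ys)// ler_wpM2r ?exprn_ge0 ?(ltW D_gt0)//.
by move: light; rewrite /heavy /= -leNgt.
Qed.

(** For a deterministic owner a one-point space with the Dirac measure is enough, and the failure
    probability becomes a count of coin outcomes. *)
Lemma steward_failure_rate {R : realType} {n d m k : nat}
    {eps' delta' eps delta : R} {S : coin_algorithm R n d m}
    {O : owner_strategy R n d unit} :
  steward k eps' delta' eps delta S -> valid_owner eps delta O ->
  #|[pred c | steward_fails S O c tt k eps']|%:R / #|{: cube m}|%:R <= delta'.
Proof.
move=> S_steward O_valid.
have := S_steward _ unit \d_tt O O_valid.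
have event c : [set w | steward_fails S O c w k eps']%classic
    = if steward_fails S O c tt k eps' then setT else set0.
  by apply/seteqP; split=> -[] /=; case: (steward_fails S O c tt k eps').
have -> : (\sum_(c : cube m) \d_tt [set w | steward_fails S O c w k eps']%classic
    = #|[pred c | steward_fails S O c tt k eps']|%:R%:E :> \bar R)%E.
  rewrite -sum1_card natr_sum -sumEFin [RHS]big_mkcond /=.
  apply: eq_bigr => c _; rewrite event inE.
  by case: ifP => _; [exact: diracT|exact: measure0].
rewrite -EFinM lee_fin mulrC; apply.
by move=> c; rewrite event; case: ifP.
Qed.

Lemma coins_ge {R : realType} {n d k m : nat} {eps delta eps' delta' : R}
    {S : coin_algorithm R n d m} :
  (0 < d)%N -> 0 < eps -> 0 < delta -> delta' < 1 ->
  steward k eps' delta' eps delta S -> pseudorandom_generation S ->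
  0 <= delta' /\ (delta * 2 ^+ n) ^+ k <= 2 ^+ m.
Proof.
move=> d_gt0 eps_gt0 delta_gt0 delta'_lt1 S_steward [q [_ S_q]].
have [e e_inj e_le] := exists_small_injection (cube n) d_gt0 eps_gt0.
(* The absolute value is there because [eps'] may have any sign. *)
pose far : 'rV[R]_d := const_mx (`|eps'| + 1).
have far_gt : eps' < `|far|.
  by rewrite norm_const_row// ger0_norm ?addr_ge0// ltr_pwDr// ler_norm.
have O_valid := valid_adversary q far e_inj e_le delta_gt0.
have cube_card : #|{: cube n}|%:R = 2 ^+ n :> R.
  by rewrite card_tuple card_bool natrX.
rewrite cube_card in O_valid.
have D_gt0 : 0 < delta * 2 ^+ n by rewrite mulr_gt0// exprn_gt0.
have := steward_failure_rate S_steward O_valid.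
set bad := [pred c | _] => bad_le; split; first exact: le_trans bad_le.
have [c ok|all_bad] := pickP (predC bad).
  have [c_ys card_ys] := surviving_round S_q far_gt D_gt0 ok.
  rewrite (le_trans _ card_ys)// ler_peMl ?exprn_ge0 ?(ltW D_gt0)//.
  by rewrite ler1n; apply/card_gt0P; exists c.
have bad_all : #|bad| = #|{: cube m}|.
  by apply: eq_card => c; have /negbFE := all_bad c; rewrite !inE.
move: bad_le; rewrite bad_all divff ?leNgt ?delta'_lt1//.
by rewrite pnatr_eq0 card_tuple card_bool expn_eq0.
Qed.

Theorem theorem7p3 (R : realType) (n d k m : nat)
    (eps delta eps' delta' : R) (S : coin_algorithm R n d m)
    (d_gt0 : (0 < d)%N) (eps_gt0 : 0 < eps) (delta_gt0 : 0 < delta)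
    (delta'_le1 : delta' <= 1)
    (S_steward : steward k eps' delta' eps delta S)
    (S_prg : pseudorandom_generation S) :
  m%:R >= (1 - delta') * (n%:R - log2 (2 / delta)) * k%:R.
Proof.
move: delta'_le1; rewrite le_eqVlt => /predU1P[->|delta'_lt1].
  by rewrite subrr !mul0r.
have [delta'_ge0 coins] := coins_ge
  d_gt0 eps_gt0 delta_gt0 delta'_lt1 S_steward S_prg.
have ln2_gt0 : 0 < ln 2 :> R by rewrite ln_gt0// ltr1n.
have pow_gt0 i : 0 < 2 ^+ i :> R by rewrite exprn_gt0.
have D_gt0 : 0 < delta * 2 ^+ n by rewrite mulr_gt0.
have logs : (ln delta + n%:R * ln 2) * k%:R <= m%:R * ln 2.
  move: coins; rewrite -ler_ln ?posrE ?exprn_gt0// !lnXn// lnM ?posrE// lnXn//.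
  by rewrite -!(mulr_natl (ln 2)) mulr_natr.
set L := n%:R - _.
have kL_le : L * k%:R <= m%:R.
  (* [L] is the base-2 logarithm of [delta * 2 ^+ n], minus 1 for the 2 in [2 / delta]. *)
  have -> : L = (ln delta + n%:R * ln 2) / ln 2 - 1.
    by rewrite /L /log2 ln_div ?posrE//; field; rewrite gt_eqF.
  by rewrite mulrBl mul1r lerBlDr ler_wpDr// mulrAC ler_pdivrMr//.
(* The factor [1 - delta'] lies in [[0, 1]]: it can only decrease a nonnegative [L * k], and a
   negative one leaves the left side at most 0. *)
rewrite -mulrA; have [kL_ge0|/ltW kL_le0] := lerP 0 (L * k%:R).
  by rewrite (le_trans _ kL_le)// ler_piMl// lerBlDr lerDl.
by rewrite (le_trans (mulr_ge0_le0 _ kL_le0))// subr_ge0 ltW.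
Qed.
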